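(* Suppose Assumptions 1–5 (stated in the context) hold. For each $i\in\mathcal V$ take any finite (possibly empty) $\overline Y_i^0\subset Y_i$ and a proper initial restriction parameter $\varepsilon_i^0>0$. Then the distributed upper bounding procedure is convergent, i.e. $\sum_{i=1}^m f_i(z_i^{k+1})\to F^*$ as $k\to\infty$.
   Context: **Problem.** Let $\mathcal V=\{1,\dots,m\}$ be a set of agents. The distributed robust convex optimization problem (DRCO) is $$\min_{x\in\mathbb R^n} F(x)=\sum_{i=1}^m f_i(x)\quad\text{s.t. } g_i(x,y_i)\le 0\ \ \forall y_i\in Y_i,\ i=1,\dots,m,$$ where $Y_i\subseteq\mathbb R^{n_y}$ is non-empty and compact, $f_i:\mathbb R^n\to\mathbb R$ is convex, and $g_i:\mathbb R^n\times Y_i\to\mathbb R$ is convex in $x$ and continuous in $y_i$. Let $X_i=\{x: g_i(x,y_i)\le 0\ \forall y_i\in Y_i\}$ (convex and compact by standing assumption), $X=\bigcap_{i=1}^m X_i$, and let $F^*$ be the optimal value of (DRCO). **Communication.** At time slot $t$ agents communicate over a directed graph $\mathcal G(t)$ on vertex set $\mathcal V$. **Assumption 1.** $X\neq\emptyset$ and $F$ is strictly convex on $\mathbb R^n$; (DRCO) is solvable with a unique optimal solution $x^*$. **Assumption 2 (uniformly strong connectivity).** There is an integer $T>0$ such that for all $t\ge0$ the graph on $\mathcal V$ whose edge set is the union of the edge sets of $\mathcal G(t),\dots,\mathcal G(t+T-1)$ is strongly connected. **Assumption 3.** There is $x_0$ with $g_i(x_0,y_i)<0$ for all $y_i\in Y_i$,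 $i=1,\dots,m$. **Assumption 4.** For distributed convex optimization problems with finitely many inequality constraints under uniformly strongly connected networks, the decision variables of all agents reach an optimal consensus solution within finitely many time slots. In particular, in each iteration of the procedure below, all agents obtain one and the same optimal solution of the approximation problem. **Assumption 5.** For each $i$ and each iteration, at each query point $\hat x_i$ the problem $\max_{y_i\in Y_i}g_i(\hat x_i,y_i)$ is globally solved, either establishing that the maximum is $\le 0$ or furnishing $\hat y_i$ with $g_i(\hat x_i,\hat y_i)>0$. **Distributed upper bounding procedure** (with reduction parameter $r>1$). For $k=0,1,2,\dots$: every agent obtains the optimal solution $z_i^{k+1}=z^{k+1}$ of $$(\mathrm{DUBD}^k)\quad \min_x F(x)\ \text{ s.t. } g_i(x,y_i)\le -\varepsilon_i^k\ \forall y_i\in\overline Y_i^k,\ i=1,\dots,m.$$ If $\max_{y_i\in Y_i}g_i(z_i^{k+1},y_i)>0$, put $\overline Y_i^{k+1}=\overline Y_i^k\cup\{\hat y_i\}$ with $\hat y_i\in\arg\max_{y_i\in Y_i}g_i(z_i^{k+1},y_i)$ and $\varepsilon_i^{k+1}=\varepsilon_i^k$; otherwise put $\overline Y_i^{k+1}=\overline Y_i^k$ and $\varepsilon_i^{k+1}=\varepsilon_i^k/r$. **Proper parameters.** The $\varepsilon_i^0>0$ are called proper if they are chosen so that the feasible set of $(\mathrm{DUBD}^k)$ is non-empty in every iteration (such values exist under Assumption 3).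
   Formalization: ''Proper'' is taken as a property of the initial restriction parameters alone: feasible sets must be non-empty in every iteration for all finite initial sets and all choices of maximizers; non-emptiness along one run does not suffice, since the iterates may then diverge. *)

(* Defs.v *)
(* MathComp-Analysis; R^n is 'rV[R]_n and the set of agents is 'I_m. *)
From HB Require Import structures.
From mathcomp Require Import all_boot all_order all_algebra.
From mathcomp Require Import all_classical all_reals all_analysis.

Set Implicit Arguments.
Unset Strict Implicit.
Unset Printing Implicit Defensive.

Import Order.TTheory GRing.Theory Num.Theory.
Import numFieldTopology.Exports.

Local Open Scope classical_set_scope.
Local Open Scope ring_scope.

Definition strictly_convex_function (R : realType) (n : nat)
    (F : 'rV[R]_n -> R) : Prop :=
  forall (x y : 'rV[R]_n) (t : R), x != y -> 0 < t -> t < 1 ->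
    F (t *: x + (1 - t) *: y) < t * F x + (1 - t) * F y.

Definition is_argmax (R : realType) (T : Type) (A : set T) (h : T -> R)
    (y : T) : Prop :=
  A y /\ forall y', A y' -> h y' <= h y.

(* Minimize the sum of the [objective i] subject to [c x <= 0] for all agents i
   and all c in [constraints i]; agent i privately owns the data of index i.
   The constraint sets may be infinite. *)
Record distributed_program (R : realType) (m n : nat) := DistributedProgram {
  objective : 'I_m -> 'rV[R]_n -> R;
  constraints : 'I_m -> set ('rV[R]_n -> R)
}.

Section DistributedProgram.
Variables (R : realType) (m n : nat).
Implicit Types P : distributed_program R m n.

Definition total_objective P (x : 'rV[R]_n) : R := \sum_(i < m) objective P i x.

Definition local_feasible P (i : 'I_m) : set 'rV[R]_n :=
  [set x | forall c, constraints P i c -> c x <= 0].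

Definition feasible P : set 'rV[R]_n :=
  [set x | forall i, local_feasible P i x].

Definition optimal P : set 'rV[R]_n :=
  [set x | feasible P x /\
           forall x', feasible P x' -> total_objective P x <= total_objective P x'].

Definition optimal_value P : R := inf (total_objective P @` feasible P).

Definition convex_program P : Prop :=
  (forall i, convex_function setT (objective P i)) /\
  (forall i c, constraints P i c -> convex_function setT c).

Definition finitely_constrained P : Prop :=
  forall i, finite_set (constraints P i).

(* [G t] is the edge relation of the directed graph at time slot t. *)
Definition strongly_connected (e : rel 'I_m) : Prop :=
  forall i j, connect e i j.

Definition uniformly_strongly_connected (G : nat -> rel 'I_m) : Prop :=
  exists2 T : nat, (0 < T)%N & forall t : nat,
    strongly_connected (fun i j => [exists s : 'I_T, G (t + s)%N i j]).

(* [A G P w]: w is a possible execution of the distributed optimization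
   algorithm A for the program P over the network G, i.e., [w t i] is the
   decision variable of agent i at time slot t. *)
Definition distributed_algorithm : Type :=
  (nat -> rel 'I_m) -> distributed_program R m n ->
  set (nat -> 'I_m -> 'rV[R]_n).

Definition finite_time_consensus (A : distributed_algorithm) : Prop :=
  forall G P w,
    uniformly_strongly_connected G ->
    convex_program P -> finitely_constrained P -> optimal P !=set0 ->
    A G P w ->
    exists2 x, optimal P x &
      exists tau : nat, forall t : nat, (tau <= t)%N -> forall i, w t i = x.

End DistributedProgram.

Section DistributedUpperBounding.
Variables (R : realType) (m n p : nat).
Variable f : 'I_m -> 'rV[R]_n -> R.
(* Only the values of [g i x] on [Y i] are relevant. *)
Variable g : 'I_m -> 'rV[R]_n -> 'rV[R]_p -> R.
Variable Y : 'I_m -> set 'rV[R]_p.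
Variable r : R.

Definition drco : distributed_program R m n :=
  DistributedProgram f (fun i => [set (g i)^~ y | y in Y i]).

Definition dubd (Yb : 'I_m -> set 'rV[R]_p) (eps : 'I_m -> R) :
    distributed_program R m n :=
  DistributedProgram f (fun i => [set (fun x => g i x y + eps i) | y in Yb i]).

(* The outcome of the maximization of [g i x] over [Y i]: [None] reports that
   the maximum is nonpositive, [Some y] furnishes a maximizer of positive
   value. *)
Definition lower_level_solved (i : 'I_m) (x : 'rV[R]_n)
    (a : option 'rV[R]_p) : Prop :=
  match a with
  | None => forall y, Y i y -> g i x y <= 0
  | Some y => is_argmax (Y i) (g i x) y /\ 0 < g i x y
  end.

Definition dubd_next_points (Yb : 'I_m -> set 'rV[R]_p)
    (a : 'I_m -> option 'rV[R]_p) (i : 'I_m) : set 'rV[R]_p :=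
  if a i is Some y then Yb i `|` [set y] else Yb i.

Definition dubd_next_restriction (eps : 'I_m -> R)
    (a : 'I_m -> option 'rV[R]_p) (i : 'I_m) : R :=
  if a i is Some _ then eps i else eps i / r.

Definition finite_discretization (Yb : 'I_m -> set 'rV[R]_p) : Prop :=
  forall i, finite_set (Yb i) /\ Yb i `<=` Y i.

(* The discretizations and restriction parameters that occur in some iteration
   of the procedure started with the restriction parameters [eps0]. *)
Inductive dubd_reachable (eps0 : 'I_m -> R) :
    ('I_m -> set 'rV[R]_p) -> ('I_m -> R) -> Prop :=
| dubd_reachable_init Yb :
    finite_discretization Yb -> dubd_reachable eps0 Yb eps0
| dubd_reachable_step Yb eps x a :
    dubd_reachable eps0 Yb eps -> optimal (dubd Yb eps) x ->
    (forall i, lower_level_solved i x (a i)) ->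
    dubd_reachable eps0 (dubd_next_points Yb a) (dubd_next_restriction eps a).

(* Properness is a property of [eps0] alone: nonemptiness is required whatever
   the finite initial discretization and the maximizers chosen on the way.
   Nonemptiness along one single run does not suffice for convergence, since
   the iterates may then be unbounded. *)
Definition proper_restriction (eps0 : 'I_m -> R) : Prop :=
  (forall i, 0 < eps0 i) /\
  forall Yb eps, dubd_reachable eps0 Yb eps -> feasible (dubd Yb eps) !=set0.

End DistributedUpperBounding.

(* Main.v *)
Require Import Defs.
From HB Require Import structures.
From mathcomp Require Import all_boot all_order all_algebra.
From mathcomp Require Import all_classical all_reals all_analysis.
From mathcomp Require Import ring lra.
From mathcomp Require Import finmap.

Set Implicit Arguments.
Unset Strict Implicit.
Unset Printing Implicit Defensive.

Import Order.TTheory GRing.Theory Num.Theory.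
Import numFieldTopology.Exports.

Local Open Scope classical_set_scope.
Local Open Scope ring_scope.

(** The argument has three parts.

    A uniform Slater point and boundedness.  Convex systems with a bounded
    nonempty solution set are controlled by finitely many of their inequalities
    ([finite_subsystem_bounded]): a finite subsystem already excludes, with a
    positive margin, every point of a sphere around a solution, and by convexity
    a far away point satisfying relaxed inequalities would produce a point of the
    sphere satisfying them almost exactly.  Applied to the compact feasible set
    of the robust program, this turns properness, which speaks of finite
    discretizations, into a single point xbar with
    g_i(xbar, y) <= - eps_i^0 for all y in Y_i ([proper_restriction_slater]).
    This point is feasible in every iteration, so F(z^k) <= F(xbar).  Applied to
    the first approximation problem, whose optimum is unique by strict convexity,
    the same lemma bounds all the iterates ([iterates_bounded]).

    Cutting planes.  The functions g_i(., y), y in Y_i, are convex and pointwise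
    bounded above, hence satisfy a one-sided Lipschitz estimate on bounded sets
    that is uniform in y ([convex_equilipschitz]).  If a maximizer found at z^k
    cuts off z^k from all later iterates by a fixed margin, then those z^k keep a
    fixed distance from each other, so by boundedness there are finitely many of
    them ([cuts_finite]).  This shows that the violations max g_i(z^k, .) become
    arbitrarily small ([violation_vanishes]) and that each restriction parameter
    is reduced until it tends to 0 ([restriction_vanishes]).

    Conclusion.  Let e > 0 be a lower bound of the eps_i^0 and x* the optimal
    solution.  If all eps_i^k <= s e, a convex combination of x* and xbar is
    feasible for the k-th problem; if all violations are <= s e, a convex
    combination of z^k and xbar is feasible for the robust program.  Both
    comparisons of objective values give
    |F(z^k) - F( x* )| <= s (F(xbar) - F( x* )). *)

(** * Families of convex functions *)

Section ConvexFamilies.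
Variable R : realType.

Lemma convex_functionP (V : lmodType R) (h : V -> R) :
  convex_function setT h <->
  forall (x y : V) (t : R), 0 <= t -> t <= 1 ->
    h (t *: x + (1 - t) *: y) <= t * h x + (1 - t) * h y.
Proof.
split=> [hc x y t t0 t1|hc t x y _ _].
  by have := hc (Itv01 t0 t1) x y (in_setT _) (in_setT _).
by apply: hc; [exact: ge0 | exact: le1].
Qed.

Lemma convex_functionD (V : lmodType R) (h1 h2 : V -> R) :
  convex_function setT h1 -> convex_function setT h2 ->
  convex_function setT (fun x => h1 x + h2 x).
Proof.
move=> /convex_functionP c1 /convex_functionP c2.
apply/convex_functionP => x y t t0 t1.
have := lerD (c1 x y t t0 t1) (c2 x y t t0 t1); lra.
Qed.

Lemma convex_function_cst (V : lmodType R) (a : R) :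
  convex_function setT (fun _ : V => a).
Proof. by apply/convex_functionP => x y t _ _; lra. Qed.

Lemma convex_function_sum (V : lmodType R) m (h : 'I_m -> V -> R) :
  (forall i, convex_function setT (h i)) ->
  convex_function setT (fun x => \sum_(i < m) h i x).
Proof.
move=> hc; apply/convex_functionP => x y t t0 t1.
rewrite !mulr_sumr -big_split /=; apply: ler_sum => i _.
by have /convex_functionP := hc i; exact.
Qed.

(** Boxes are treated by adding one direction e_j at a time: a point of the box is
    the midpoint of a point of the segment from - 2 rho e_j to 2 rho e_j and of a
    point of the doubled box of lower dimension, and on the segment the family is
    bounded by its bounds at the two end points. *)
Lemma convex_span_ubound (V : lmodType R) (H : set (V -> R)) (J : Type)
    (e : J -> V) (s : seq J) :
  (forall h, H h -> convex_function setT h) ->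
  (forall x, exists M, forall h, H h -> h x <= M) ->
  forall rho, 0 < rho -> exists M, forall h (c : J -> R), H h ->
    (forall j, `|c j| <= rho) -> h (\sum_(j <- s) c j *: e j) <= M.
Proof.
move=> Hc Hb; elim: s => [|j s IHs] rho rho0.
  have [M HM] := Hb 0; exists M => h c Hh _.
  by rewrite big_nil; exact: HM.
have rho20 : 0 < 2 * rho by lra.
have [M1 HM1] := IHs _ rho20.
have [M2 HM2] := Hb ((2 * rho) *: e j).
have [M3 HM3] := Hb (- (2 * rho) *: e j).
exists (`|M1| + `|M2| + `|M3|) => h c Hh crho; rewrite big_cons.
have /convex_functionP hc := Hc _ Hh.
set S := \sum_(k <- s) (2 * c k) *: e k.
have hS : h S <= M1.
  apply: HM1 => // k; rewrite normrM ger0_norm //.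
  by have := crho k; lra.
(* the position of 2 c_j on the segment from - 2 rho to 2 rho *)
pose t := (c j / rho + 1) / 2.
have cj : `|c j / rho| <= 1.
  by rewrite normrM normfV (gtr0_norm rho0) ler_pdivrMr // mul1r.
have [t0 t1] : 0 <= t /\ t <= 1.
  by move: cj; rewrite ler_norml /t => /andP[]; lra.
have -> : c j *: e j + \sum_(k <- s) c k *: e k =
    2^-1 *: (t *: ((2 * rho) *: e j) + (1 - t) *: (- (2 * rho) *: e j)) +
    (1 - 2^-1) *: S.
  congr (_ + _).
    rewrite !scalerA -scalerDl scalerA; congr (_ *: _).
    by rewrite /t; field; rewrite gt_eqF.
  rewrite scaler_sumr; apply: eq_bigr => k _.
  by rewrite scalerA; congr (_ *: _); field.
have h1 := hc (t *: ((2 * rho) *: e j) + (1 - t) *: (- (2 * rho) *: e j)) S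
  2^-1 ltac:(lra) ltac:(lra).
have h2 := hc ((2 * rho) *: e j) (- (2 * rho) *: e j) t t0 t1.
have {}HM2 := HM2 _ Hh; have {}HM3 := HM3 _ Hh.
have N1 := ler_norm M1; have N2 := ler_norm M2; have N3 := ler_norm M3.
have P2 := normr_ge0 M2; have P3 := normr_ge0 M3; have P1 := normr_ge0 M1.
have h3 : t * h ((2 * rho) *: e j) <= `|M2|.
  apply: (@le_trans _ _ (t * `|M2|)); last by rewrite ler_piMl.
  by rewrite ler_wpM2l // (le_trans HM2).
have h4 : (1 - t) * h (- (2 * rho) *: e j) <= `|M3|.
  apply: (@le_trans _ _ ((1 - t) * `|M3|)); last by rewrite ler_piMl //; lra.
  by rewrite ler_wpM2l ?(le_trans HM3) //; lra.
lra.
Qed.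

Lemma coord_le_norm n (x : 'rV[R]_n) j : `|x 0 j| <= `|x|.
Proof.
rewrite [leRHS]mx_normrE.
by apply: (le_bigmax _ (fun ij : 'I_1 * 'I_n => `|x ij.1 ij.2|) (0, j)).
Qed.

Lemma convex_ball_ubound n (H : set ('rV[R]_n -> R)) :
  (forall h, H h -> convex_function setT h) ->
  (forall x, exists M, forall h, H h -> h x <= M) ->
  forall rho, 0 < rho ->
    exists M, forall h x, H h -> `|x| <= rho -> h x <= M.
Proof.
move=> Hc Hb rho rho0.
have [M HM] := convex_span_ubound (fun j : 'I_n => 'e_j : 'rV[R]_n)
  (enum 'I_n) Hc Hb rho0.
exists M => h x Hh xrho; rewrite [x]row_sum_delta -big_enum.
by apply: HM => // j; exact: le_trans (coord_le_norm _ _) xrho.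
Qed.

(** Prolonging the segment from [x'] to [x] by a unit length gives a point where
    the family is bounded by [M], and [x] is a convex combination of that point
    and [x']; multiplying out the weights gives the estimate. *)
Lemma convex_equilipschitz n (H : set ('rV[R]_n -> R)) :
  (forall h, H h -> convex_function setT h) ->
  (forall x, exists M, forall h, H h -> h x <= M) ->
  forall rho, 0 < rho ->
    exists2 M, 0 < M & forall h x x', H h -> `|x| <= rho -> `|x'| <= rho ->
      (1 + `|x - x'|) * h x <= h x' + `|x - x'| * M.
Proof.
move=> Hc Hb rho rho0.
have [M HM] := convex_ball_ubound Hc Hb (ltr_pwDr (@ltr01 R) (ltW rho0)).
exists (`|M| + 1); first by have := normr_ge0 M; lra.
move=> h x x' Hh xrho x'rho.
have [->|xx'] := eqVneq x x'; first by rewrite subrr normr0; lra.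
set s := `|x - x'|.
have s0 : 0 < s by rewrite normr_gt0 subr_eq0.
have sn0 : s != 0 by rewrite gt_eqF.
have sn1 : 1 + s != 0 by rewrite gt_eqF //; lra.
(* the prolonged segment ends at distance 1 beyond x *)
pose q := x + s^-1 *: (x - x').
have hq : h q <= M.
  apply: HM => //; apply: (le_trans (ler_normD _ _)).
  rewrite normrZ normfV (gtr0_norm s0) mulVf ?gt_eqF //; lra.
have /convex_functionP hc := Hc _ Hh.
pose t := s / (1 + s).
have t0 : 0 <= t by rewrite divr_ge0 //; lra.
have t1 : t <= 1 by rewrite ler_pdivrMr; lra.
have xE : x = t *: q + (1 - t) *: x'.
  apply/rowP => j; rewrite !mxE /t; field.
  by rewrite sn0 sn1.
have := hc q x' t t0 t1; rewrite -xE -(ler_pM2l (_ : 0 < 1 + s)); last lra.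
move=> hx; apply: (le_trans hx).
have -> : (1 + s) * (t * h q + (1 - t) * h x') = s * h q + h x'.
  by rewrite /t; field.
rewrite addrC lerD2l ler_pM2l //.
by have := ler_norm M; lra.
Qed.

Lemma cvg_at_normP (V : normedModType R) (h : V -> R) (x0 : V) :
  (forall e, 0 < e -> exists2 d, 0 < d &
     forall x, `|x0 - x| < d -> `|h x0 - h x| <= e) ->
  h x @[x --> x0] --> h x0.
Proof.
move=> H; apply/cvgrPdist_le => e e0; have [d d0 Hd] := H e e0.
by apply/nbhs_normP; exists d => //= x; exact: Hd.
Qed.

(** Both halves of the continuity estimate come from [convex_equilipschitz], used
    once in each direction. *)
Lemma convex_continuous n (h : 'rV[R]_n -> R) :
  convex_function setT h -> continuous h.
Proof.
move=> hc x0.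
have [|||M M0 HM] := @convex_equilipschitz n [set h] _ _ (`|x0| + 1).
- by move=> _ ->.
- by move=> x; exists (h x) => _ ->.
- by have := normr_ge0 x0; lra.
have {HM} HM x x' : `|x| <= `|x0| + 1 -> `|x'| <= `|x0| + 1 ->
    (1 + `|x - x'|) * h x <= h x' + `|x - x'| * M by exact: HM.
apply: cvg_at_normP => e e0.
pose C := M + `|h x0|.
have C0 : 0 < C by have := normr_ge0 (h x0); rewrite /C; lra.
exists (Num.min 1 (e / C)); first by rewrite lt_min ltr01 divr_gt0.
move=> x; rewrite lt_min => /andP[/ltW xx0 /ltW xe].
have nx : `|x| <= `|x0| + 1.
  have := ler_normB x0 (x0 - x); rewrite opprB addrC subrK; lra.
have nx0 : `|x0| <= `|x0| + 1 by lra.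
have := HM _ _ nx nx0; have := HM _ _ nx0 nx; rewrite (distrC x x0).
have sC : `|x0 - x| * C <= e by rewrite -ler_pdivlMr.
move: sC xx0; have := normr_ge0 (x0 - x); move: `|x0 - x| => s s0 sC s1 H1 H2.
have N1 := ler_norm (h x0); have N2 := ler_norm (- h x0); rewrite normrN in N2.
have B1 : s * (M - h x0) <= s * C by rewrite ler_wpM2l // /C; lra.
rewrite ler_norml; apply/andP; split; last by move: B1 H1; lra.
have [d0|d0] := leP (h x) (h x0); first by lra.
have P : 0 <= s * (h x - h x0) by rewrite mulr_ge0 //; lra.
move: B1 H2 P; lra.
Qed.

Lemma convex_sublevel_closed n (h : 'rV[R]_n -> R) a :
  convex_function setT h -> closed [set x | h x <= a].
Proof.
move=> hc; apply: (@preimage_closed _ _ h [set y | y <= a]).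
  by move=> x _; exact: convex_continuous.
exact: closed_le.
Qed.

End ConvexFamilies.

(** * Systems of convex inequalities with a bounded solution set *)

Lemma compact_finite_subfamily (T : ptopologicalType) (I : choiceType)
    (A : set T) (DI : set I) (F : I -> set T) :
  compact A -> (forall i, DI i -> closed (F i)) ->
  (forall D' : set I, finite_set D' -> D' `<=` DI ->
     exists2 x, A x & forall i, D' i -> F i x) ->
  exists2 x, A x & forall i, DI i -> F i x.
Proof.
move=> Ac Fc Hfin.
have [[i0 Di0]|DI0] := pselect (DI !=set0); last first.
  have [||x Ax _] := Hfin set0 => //.
  by exists x => // i Di; case: DI0; exists i.
move: Ac; rewrite compact_In0 /= => /(_ I DI (fun i => A `&` F i)).
case=> [|D' D'D|x Hx].
- by exists F.
- have [|i /= iD'|x Ax Fx] := Hfin [set` D']; first exact: finite_fset.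
    exact/set_mem/D'D.
  by exists x => i iD'; split => //; exact: Fx.
by exists x => [|i Di]; [have [] := Hx _ Di0 | have [] := Hx _ Di].
Qed.

Lemma finite_positive_lbound (R : realType) (I : choiceType) (D' : set I)
    (v : I -> R) :
  finite_set D' -> (forall i, D' i -> 0 < v i) ->
  exists2 e, 0 < e & forall i, D' i -> e <= v i.
Proof.
move=> /finite_seqP[s ->] vpos.
exists (\big[Num.min/1]_(i <- s) v i).
  rewrite big_seq; elim/big_ind: _ => //= x y x0 y0.
  by rewrite lt_min x0.
move=> i /= si.
exact: ge_bigmin_seq.
Qed.

Lemma closed_norm_preimage (R : realType) (V : normedModType R) (c : V)
    (A : set R) :
  closed A -> closed [set x : V | A `|x - c|].
Proof.
move=> Ac; apply: (@preimage_closed _ _ (fun x : V => `|x - c|)) => // x _.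
by apply: cvg_norm; apply: cvgB; [exact: cvg_id | exact: cvg_cst].
Qed.

Lemma norm_ball_compact (R : realType) n (c : 'rV[R]_n) (A : set R) (r : R) :
  closed A -> (forall y, A y -> y <= r) ->
  compact [set x : 'rV[R]_n | A `|x - c|].
Proof.
move=> Ac Ar; apply: bounded_closed_compact; last exact: closed_norm_preimage.
exists (r + `|c|); split; first exact: num_real.
move=> M ltM u /= /Ar uA; have := ler_normD (u - c) c.
by rewrite subrK; lra.
Qed.

Section ConvexSystems.
Variables (R : realType) (n : nat) (J : choiceType).
Variables (D : set J) (h : J -> 'rV[R]_n -> R) (x1 : 'rV[R]_n) (b : R).

Hypothesis h_convex : forall j, D j -> convex_function setT (h j).
Hypothesis x1_sol : forall j, D j -> h j x1 <= 0.
Hypothesis sol_bounded : forall x, (forall j, D j -> h j x <= 0) -> `|x| <= b.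

(** Let S be a sphere around the solution [x1] that encloses all solutions.  No
    point of S satisfies h_j <= d for all j and all d > 0, so by compactness
    finitely many of these inequalities are incompatible on S; let e be the least of their
    right-hand sides.  A point x with h_j(x) <= c at distance tau times the
    radius of S from [x1] gives the point [x1] + (x - [x1]) / tau of S, where
    h_j <= c / tau by convexity; this forces tau <= max(1, |c| / e). *)
Lemma finite_subsystem_bounded :
  exists D' : set J, [/\ finite_set D', D' `<=` D &
    forall c, exists rho, forall x, (forall j, D' j -> h j x <= c) ->
      `|x| <= rho].
Proof.
pose rho := `|b| + `|x1| + 1.
have rho0 : 0 < rho by rewrite /rho; have := normr_ge0 b; have := normr_ge0 x1; lra.
pose S := [set u : 'rV[R]_n | `|u - x1| = rho].
have S_compact : compact S.
  by apply: (@norm_ball_compact _ _ x1 [set rho] rho) => [|y ->//];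
    exact: closed_eq.
(* a pair (j, d) stands for the inequality h_j <= d *)
pose DI := [set q : J * R | D q.1 /\ 0 < q.2].
pose F (q : J * R) := [set u | h q.1 u <= q.2].
have F_closed q : DI q -> closed (F q).
  by case=> Dq _; apply: convex_sublevel_closed; exact: h_convex.
have [Hfin|] := pselect (forall D' : set (J * R), finite_set D' -> D' `<=` DI ->
     exists2 x, S x & forall i, D' i -> F i x).
  have [u /= uS Fu] := compact_finite_subfamily S_compact F_closed Hfin.
  have : `|u| <= b.
    apply: sol_bounded => j Dj; apply/ler_addgt0Pr => e e0; rewrite add0r.
    exact: (Fu (j, e)).
  have := ler_normB u x1; rewrite uS /rho; have := ler_norm b; lra.
move=> /existsNP[D'' /not_implyP[finD'' /not_implyP[D''D HD'']]].
have [e e0 He] := finite_positive_lbound (v := snd) finD''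
  (fun q q' => (D''D q q').2).
exists [set q.1 | q in D'']; split.
- exact: finite_image.
- by move=> _ [q /D''D[Dq _] <-].
move=> c; exists (`|x1| + rho * (1 + `|c| / e)) => x xc.
rewrite leNgt; apply/negP => xlt; apply: HD''.
pose tau := `|x - x1| / rho.
have tau_gt : 1 + `|c| / e < tau.
  rewrite ltr_pdivlMr // mulrC.
  by have := ler_normD (x - x1) x1; rewrite subrK; lra.
have ce0 : 0 <= `|c| / e by rewrite divr_ge0 // ltW.
have tau0 : 0 < tau by lra.
have tauN0 : tau != 0 by rewrite gt_eqF.
have ti0 : 0 <= tau^-1 by rewrite invr_ge0 ltW.
have ti1 : tau^-1 <= 1 by rewrite invf_le1 //; lra.
exists (tau^-1 *: x + (1 - tau^-1) *: x1).
  rewrite /S /=.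
  have -> : tau^-1 *: x + (1 - tau^-1) *: x1 - x1 = tau^-1 *: (x - x1).
    by rewrite scalerBl scale1r scalerBr addrA addrAC addrK.
  rewrite normrZ ger0_norm // /tau invf_div mulrVK // unitfE.
  by move: tauN0; rewrite /tau mulf_eq0 negb_or => /andP[].
move=> [j d] jd; rewrite /F /=.
have [Dj _] := D''D _ jd.
have /convex_functionP hc := h_convex Dj.
apply: (le_trans (hc _ _ _ ti0 ti1)).
have h1 : (1 - tau^-1) * h j x1 <= 0.
  by rewrite mulr_ge0_le0 ?subr_ge0 //; exact: x1_sol.
have h2 : tau^-1 * h j x <= e.
  rewrite mulrC ler_pdivrMr //.
  have := xc j (ex_intro2 _ _ _ jd erefl).
  have : `|c| <= e * tau by rewrite mulrC -ler_pdivrMr //; lra.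
  by have := ler_norm c; lra.
by have /= := He _ jd; lra.
Qed.

(** [finite_subsystem_bounded] provides the compact set on which the finite
    intersection property applies. *)
Lemma tightened_system_solvable (a : J -> R) :
  (forall j, D j -> 0 <= a j) ->
  (forall D' : set J, finite_set D' -> D' `<=` D ->
     exists x, forall j, D' j -> h j x + a j <= 0) ->
  exists x, forall j, D j -> h j x + a j <= 0.
Proof.
move=> a0 Hfin.
have [D0 [finD0 D0D /(_ 0)[rho Hrho]]] := finite_subsystem_bounded.
pose A := [set x : 'rV[R]_n | `|x - 0| <= rho].
have A_compact : compact A.
  by apply: (@norm_ball_compact _ _ 0 [set y | y <= rho] rho) => //;
    exact: closed_le.
pose F j := [set u | h j u <= - a j].
have F_closed j : D j -> closed (F j).
  by move=> Dj; apply: convex_sublevel_closed; exact: h_convex.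
have [|x Ax Fx] := compact_finite_subfamily A_compact F_closed.
  move=> D' finD' D'D.
  have [||x Hx] := Hfin (D0 `|` D').
  - by rewrite finite_setU.
  - by move=> j [/D0D|/D'D].
  exists x => [|j D'j]; last by have := Hx j (or_intror D'j); rewrite /F /=; lra.
  rewrite /A /= subr0; apply: Hrho => j D0j; have := Hx j (or_introl D0j).
  by have := a0 j (D0D _ D0j); lra.
by exists x => j /Fx; rewrite /F /=; lra.
Qed.

End ConvexSystems.

(** * Cutting planes *)

(** A sequence in a compact set has a cluster point along any infinite set of
    indices, and two terms near it are near each other. *)
Lemma compact_close_pair (R : realType) (V : normedModType R) (A : set V)
    (z : nat -> V) (B : set nat) (eta : R) :
  compact A -> (forall k, A (z k)) -> (forall K, exists2 k, (K <= k)%N & B k) ->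
  0 < eta ->
  exists k l, [/\ (k < l)%N, B k, B l & `|z k - z l| < eta].
Proof.
move=> Ac zA Binf eta0.
have /choice[s Hs] K : exists k, (K <= k)%N /\ B k.
  by have [k Kk Bk] := Binf K; exists k.
have [|q [_ qcl]] := Ac ((z \o s) @ \oo) (fmap_proper_filter _ _).
  by exists 0%N => // k _; exact: zA.
have eta20 : 0 < eta / 2 by rewrite divr_gt0.
have near_q K : exists2 k, (K <= k)%N & B k /\ `|q - z k| < eta / 2.
  have [||_ [[k /= Kk <-] qk]] :=
      qcl (z @` [set k | (K <= k)%N /\ B k]) (ball q (eta / 2)).
  - exists K => // k /= Kk; exists (s k) => //.
    by have [sk Bsk] := Hs k; split => //; exact: leq_trans Kk sk.
  - exact: nbhsx_ballx.
  case: Kk => Kk Bk; exists k => //; split => //.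
  by move: qk; rewrite -ball_normE.
have [k _ [Bk qk]] := near_q 0%N.
have [l kl [Bl ql]] := near_q k.+1.
exists k, l; split => //.
by rewrite (splitr eta) (le_lt_trans (ler_distD q _ _)) // ltrD // distrC.
Qed.

(** By [convex_equilipschitz], a drop of [h k] by at least [delta] between z_k,
    where it is nonnegative, and z_l forces these points to be at least
    [delta] / M apart; infinitely many such indices would contradict
    [compact_close_pair]. *)
Lemma cuts_finite (R : realType) n (H : set ('rV[R]_n -> R)) (rho delta : R)
    (z : nat -> 'rV[R]_n) (B : set nat) (h : nat -> 'rV[R]_n -> R) :
  (forall c, H c -> convex_function setT c) ->
  (forall x, exists M, forall c, H c -> c x <= M) ->
  (forall k, `|z k| <= rho) -> 0 < delta ->
  (forall k, B k -> H (h k) /\ 0 <= h k (z k)) ->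
  (forall k l, (k < l)%N -> B k -> B l -> h k (z l) + delta <= h k (z k)) ->
  exists K, forall k, (K <= k)%N -> ~ B k.
Proof.
move=> Hc Hb zrho delta0 HB Hcut; apply: contrapT => Bnfin.
have Binf K : exists2 k, (K <= k)%N & B k.
  apply: contrapT => noB; apply: Bnfin; exists K => k Kk Bk.
  by apply: noB; exists k.
have zrho1 k : `|z k| <= `|rho| + 1.
  by rewrite (le_trans (zrho k)) //; have := ler_norm rho; lra.
have rho0 : 0 < `|rho| + 1 by have := normr_ge0 rho; lra.
have [M M0 HM] := convex_equilipschitz Hc Hb rho0.
have Ac := norm_ball_compact (c := (0 : 'rV[R]_n)) (@closed_le _ (`|rho| + 1))
  (fun y yA => yA).
have [|k [l [kl Bk Bl]]] := compact_close_pair (z := z) Ac _ Binf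
  (divr_gt0 delta0 M0).
  by move=> k /=; rewrite subr0.
rewrite ltr_pdivlMr // => small.
have [Hk hk0] := HB k Bk.
have := HM _ _ _ Hk (zrho1 k) (zrho1 l); have := Hcut k l kl Bk Bl.
have : 0 <= `|z k - z l| * h k (z k) by rewrite mulr_ge0.
lra.
Qed.

(** * The upper bounding procedure *)

Section Procedure.
Variables (R : realType) (m n p : nat).
Variables (f : 'I_m -> 'rV[R]_n -> R) (g : 'I_m -> 'rV[R]_n -> 'rV[R]_p -> R).
Variables (Y : 'I_m -> set 'rV[R]_p).

Local Notation F := (total_objective (drco f g Y)).

Lemma drco_feasibleP x :
  feasible (drco f g Y) x <-> forall i y, Y i y -> g i x y <= 0.
Proof.
split=> [xX i y Yy|xX i _ [y Yy <-]]; last exact: xX.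
by apply: (xX i ((g i)^~ y)); exists y.
Qed.

Lemma dubd_feasibleP Yb eps x :
  feasible (dubd f g Yb eps) x <-> forall i y, Yb i y -> g i x y + eps i <= 0.
Proof.
split=> [xX i y Yy|xX i _ [y Yy <-]]; last exact: xX.
by apply: (xX i (fun x => g i x y + eps i)); exists y.
Qed.

Lemma optimal_value_min (P : distributed_program R m n) x :
  optimal P x -> optimal_value P = total_objective P x.
Proof.
move=> [xP xmin]; apply/eqP; rewrite eq_le; apply/andP; split.
  apply: ge_inf; last by exists x.
  by exists (total_objective P x) => _ [x' x'P <-]; exact: xmin.
apply: lb_le_inf; first by exists (total_objective P x), x.
by move=> _ [x' x'P <-]; exact: xmin.
Qed.

Hypothesis f_convex : forall i, convex_function setT (f i).
Hypothesis g_convex : forall i y, Y i y -> convex_function setT ((g i)^~ y).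

Lemma total_objective_convex : convex_function setT F.
Proof. exact: convex_function_sum. Qed.

Lemma constraint_slice_ubound i x :
  compact (Y i) -> {within Y i, continuous (g i x)} ->
  exists M, forall y, Y i y -> g i x y <= M.
Proof.
move=> Yc gc; have /compact_bounded[M [_ HM]] := continuous_compact gc Yc.
exists (M + 1) => y Yy; apply: le_trans (ler_norm _) _.
by apply: (HM (M + 1)); [rewrite ltrDl | exists y].
Qed.

(** Properness is used through all possible initial discretizations: they realize
    every finite subsystem of the robustly tightened constraints, and
    [tightened_system_solvable] passes to the whole system. *)
Lemma proper_restriction_slater r eps0 b :
  feasible (drco f g Y) !=set0 ->
  (forall x, feasible (drco f g Y) x -> `|x| <= b) ->
  proper_restriction f g Y r eps0 ->
  exists x, forall i y, Y i y -> g i x y + eps0 i <= 0.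
Proof.
move=> [x1 /drco_feasibleP x1X] Xb [eps_gt0 eps_feasible].
have [|||||x Hx] := @tightened_system_solvable R n ('I_m * 'rV[R]_p)%type
  [set q | Y q.1 q.2] (fun q x => g q.1 x q.2) x1 b _ _ _ (fun q => eps0 q.1).
- by move=> [i y] /= Yy; exact: g_convex.
- by move=> [i y] /= Yy; exact: x1X.
- by move=> x xX; apply: Xb; apply/drco_feasibleP => i y Yy; exact: (xX (i, y)).
- by move=> [i y] _ /=; exact: ltW.
- move=> D' finD' D'Y.
  have [|x /dubd_feasibleP xD'] := eps_feasible (fun i => [set y | D' (i, y)]) eps0.
    apply: dubd_reachable_init => i; split=> [|y]; last exact: D'Y.
    apply: (@sub_finite_set _ _ (snd @` D')); last exact: finite_image.
    by move=> y /= iy; exists (i, y).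
  by exists x => -[i y] /= /xD'.
by exists x => i y Yy; exact: (Hx (i, y)).
Qed.

(** By strict convexity z0 is the only point that is feasible and has objective
    value at most F(z0).  Since the solution set of this system of convex
    inequalities is a singleton, [finite_subsystem_bounded] bounds the solutions
    of the relaxed system as well.  This makes up for the fact that F itself need
    not be coercive. *)
Lemma strict_optimum_sublevel_bounded Yb eps z0 :
  finite_discretization Y Yb ->
  (forall i, 0 < eps i) -> strictly_convex_function F ->
  optimal (dubd f g Yb eps) z0 ->
  forall v, exists rho, forall x,
    (forall i y, Yb i y -> g i x y <= 0) -> F x <= v -> `|x| <= rho.
Proof.
move=> YbY eps_gt0 F_strict [/dubd_feasibleP z0X z0min] v.
have YbS i y : Yb i y -> Y i y by have [_] := YbY i; exact.
(* None stands for the objective inequality F <= F z0, Some (i, y) for the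
   restricted constraint of agent i at y *)
have [|||D' [_ D'D /(_ (\sum_(i < m) eps i + `|v - F z0|))[rho Hrho]]] :=
  @finite_subsystem_bounded R n (option ('I_m * 'rV[R]_p))
  [set o | if o is Some q then Yb q.1 q.2 else True]
  (fun o x => if o is Some q then g q.1 x q.2 + eps q.1 else F x - F z0)
  z0 `|z0|.
- move=> [[i y] /= /YbS Yy|_].
    by apply: convex_functionD; [exact: g_convex | exact: convex_function_cst].
  by apply: convex_functionD; [exact: total_objective_convex
                             | exact: convex_function_cst].
- by move=> [[i y] /= Yy|_]; [exact: z0X | rewrite subrr].
- move=> x Hx; have [->//|xz0] := eqVneq x z0.
  have Fx : F x <= F z0 by have := Hx None I; rewrite subr_le0.
  have := F_strict x z0 2^-1 xz0 ltac:(lra) ltac:(lra).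
  suff : F z0 <= F (2^-1 *: x + (1 - 2^-1) *: z0) by lra.
  apply: z0min; apply/dubd_feasibleP => i y Yy.
  have /convex_functionP gc := g_convex (YbS i y Yy).
  have := gc x z0 2^-1 ltac:(lra) ltac:(lra).
  by have := Hx (Some (i, y)) Yy; have := z0X i y Yy; rewrite /=; lra.
exists rho => x xY Fx; apply: Hrho => -[[i y] /D'D /= Yy|_].
  have ei : eps i <= \sum_(i < m) eps i.
    rewrite (bigD1 i) //= lerDl; apply: sumr_ge0 => k _; exact: ltW.
  by have := xY i y Yy; have := normr_ge0 (v - F z0); lra.
have e0 : 0 <= \sum_(i < m) eps i by apply: sumr_ge0 => k _; exact: ltW.
by have := ler_norm (v - F z0); lra.
Qed.

Lemma discretizations_finite (Yb : nat -> 'I_m -> set 'rV[R]_p)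
    (yhat : nat -> 'I_m -> option 'rV[R]_p) (x : nat -> 'I_m -> 'rV[R]_n) :
  finite_discretization Y (Yb 0%N) ->
  (forall k i, lower_level_solved g Y i (x k i) (yhat k i)) ->
  (forall k, Yb k.+1 = dubd_next_points (Yb k) (yhat k)) ->
  forall k, finite_discretization Y (Yb k).
Proof.
move=> Yb0 solved update; elim=> // k IHk i; have [fin sub] := IHk i.
rewrite update /dubd_next_points; have := solved k i.
case: (yhat k i) => // y [[Yy _] _]; split; first by rewrite finite_setU; split.
by rewrite subUset; split => // _ ->.
Qed.

Variable r : R.
Variables (Yb : nat -> 'I_m -> set 'rV[R]_p) (eps : nat -> 'I_m -> R).
Variables (z : nat -> 'rV[R]_n) (yhat : nat -> 'I_m -> option 'rV[R]_p).
Hypothesis Y_compact : forall i, compact (Y i).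
Hypothesis g_continuous : forall i x, {within Y i, continuous (g i x)}.
Hypothesis r_gt1 : 1 < r.
Hypothesis Yb0_finite : finite_discretization Y (Yb 0%N).
Hypothesis eps0_gt0 : forall i, 0 < eps 0%N i.
Hypothesis z_optimal : forall k, optimal (dubd f g (Yb k) (eps k)) (z k).
Hypothesis yhat_solved : forall k i, lower_level_solved g Y i (z k) (yhat k i).
Hypothesis Yb_update : forall k, Yb k.+1 = dubd_next_points (Yb k) (yhat k).
Hypothesis eps_update :
  forall k, eps k.+1 = dubd_next_restriction r (eps k) (yhat k).

Lemma restriction_gt0 k i : 0 < eps k i.
Proof.
elim: k => [//|k IHk]; rewrite eps_update /dubd_next_restriction.
by case: (yhat k i) => // ; rewrite divr_gt0 // (lt_trans ltr01).
Qed.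

Lemma restriction_nonincreasing k l i : (k <= l)%N -> eps l i <= eps k i.
Proof.
move=> /subnK <-; elim: (l - k)%N => [//|j IHj]; apply: le_trans IHj.
rewrite addSn eps_update /dubd_next_restriction.
case: (yhat _ i) => // ; rewrite ler_pdivrMr ?(lt_trans ltr01) //.
by rewrite ler_peMr // ltW // restriction_gt0.
Qed.

Lemma discretization_nondecreasing k l i : (k <= l)%N -> Yb k i `<=` Yb l i.
Proof.
move=> /subnK <-; elim: (l - k)%N => [//|j IHj]; apply: subset_trans IHj _.
rewrite addSn Yb_update /dubd_next_points.
by case: (yhat _ i) => // y; exact: subsetUl.
Qed.

Lemma discretization_sub k i : Yb k i `<=` Y i.
Proof. by have [] := discretizations_finite Yb0_finite yhat_solved Yb_update k i. Qed.

Lemma iterate_cut k l i y :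
  yhat k i = Some y -> (k < l)%N -> g i (z l) y + eps l i <= 0.
Proof.
move=> ky kl; have [/dubd_feasibleP zX _] := z_optimal l.
apply: zX; apply: (discretization_nondecreasing kl).
by rewrite Yb_update /dubd_next_points ky; right.
Qed.

Variable xbar : 'rV[R]_n.
Hypothesis xbar_slater : forall i y, Y i y -> g i xbar y + eps 0%N i <= 0.
Hypothesis F_strict : strictly_convex_function F.

(** All iterates satisfy the constraints of the first problem up to the
    restriction, and F is at most F(xbar) at each of them. *)
Lemma iterates_bounded : exists rho, forall k, `|z k| <= rho.
Proof.
have [rho Hrho] := strict_optimum_sublevel_bounded Yb0_finite eps0_gt0 F_strict
  (z_optimal 0) (F xbar).
exists rho => k; have [/dubd_feasibleP zX zmin] := z_optimal k.
apply: Hrho => [i y Yy|].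
  have := zX i y (discretization_nondecreasing (leq0n k) Yy).
  by have := restriction_gt0 k i; lra.
apply: zmin; apply/dubd_feasibleP => i y /discretization_sub /xbar_slater.
by have := restriction_nonincreasing i (leq0n k); lra.
Qed.

Let violation k i : 'rV[R]_n -> R :=
  if yhat k i is Some y then (g i)^~ y else fun=> 0.

(** The form of [cuts_finite] for the constraint functions of one agent at the
    maximizers it found. *)
Lemma cuts_of_agent_finite i (delta : R) (B : set nat) :
  0 < delta ->
  (forall k, B k -> exists2 y, yhat k i = Some y &
     forall l, (k < l)%N -> g i (z l) y + delta <= g i (z k) y) ->
  exists K, forall k, (K <= k)%N -> ~ B k.
Proof.
move=> delta0 HB; have [rho zrho] := iterates_bounded.
apply: (@cuts_finite R n [set (g i)^~ y | y in Y i] rho delta z B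
  (fun k => violation k i)) => //.
- by move=> _ [y Yy <-]; exact: g_convex.
- move=> x; have [M HM] := constraint_slice_ubound (@Y_compact i) (@g_continuous i x).
  by exists M => _ [y Yy <-]; exact: HM.
- move=> k Bk; have [y ky _] := HB k Bk; rewrite /violation ky.
  have := yhat_solved k i; rewrite ky => -[[Yy _] g0].
  by split; [exists y | exact: ltW].
- move=> k l kl Bk _; have [y ky Hy] := HB k Bk.
  by rewrite /violation ky; exact: Hy.
Qed.

(** A violation of at least [d] at z_k is followed by iterates at which the
    same constraint is nonpositive, so it is a cut of depth [d]. *)
Lemma violation_vanishes i d : 0 < d ->
  exists K, forall k, (K <= k)%N -> forall y, Y i y -> g i (z k) y <= d.
Proof.
move=> d0; have [||K HK] := @cuts_of_agent_finite i d
  [set k | exists2 y, yhat k i = Some y & d <= g i (z k) y] => //.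
  move=> k [y ky dy]; exists y => // l kl.
  by have := iterate_cut ky kl; have := restriction_gt0 l i; lra.
exists K => k Kk y Yy; have := yhat_solved k i; have := HK k Kk.
rewrite /=; case: (yhat k i) => [y' H|_ g_le0]; last exact: le_trans (g_le0 y Yy) (ltW d0).
move=> [[_ ymax] _]; apply: le_trans (ymax y Yy) _.
by rewrite leNgt; apply/negP => lt; apply: H; exists y' => //; exact: ltW.
Qed.

(** If the restriction stayed above [d], the constraint of each maximizer found
    would be at most - [d] at all later iterates, again a cut of depth [d].  Hence from some
    iteration on there would be no violation, and the restriction would decrease
    by at least [d] (1 - 1 / r) each time, which is absurd. *)
Lemma restriction_vanishes i d : 0 < d ->
  exists K, forall k, (K <= k)%N -> eps k i <= d.
Proof.
move=> d0; apply: contrapT => Hno.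
have eps_gt k : d < eps k i.
  rewrite ltNge; apply/negP => epsd; apply: Hno; exists k => l kl.
  exact: le_trans (restriction_nonincreasing i kl) epsd.
have [||K HK] := @cuts_of_agent_finite i d [set k | isSome (yhat k i)] => //.
  move=> k /=; case ky: (yhat k i) => [y|] // _; exists y => // l kl.
  have := yhat_solved k i; rewrite ky => -[_ gy].
  by have := iterate_cut ky kl; have := eps_gt l; lra.
pose c := d * (1 - r^-1).
have r0 : 0 < r by exact: lt_trans ltr01 _.
have ri : r^-1 < 1 by rewrite invf_lt1.
have c0 : 0 < c by rewrite mulr_gt0 // subr_gt0.
have decr j : eps (K + j)%N i + c * j%:R <= eps K i.
  elim: j => [|j IHj]; first by rewrite addn0 mulr0 addr0.
  have := HK (K + j)%N (leq_addr _ _); rewrite addnS eps_update /=.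
  rewrite /dubd_next_restriction; case: (yhat _ i) => [y /(_ isT)//|_].
  have h1 : c <= eps (K + j)%N i * (1 - r^-1).
    by rewrite ler_pM2r ?subr_gt0 //; exact: ltW.
  by rewrite -natr1; move: IHj h1; rewrite mulrDr; lra.
have := archi_boundP (ltW (divr_gt0 (restriction_gt0 K i) c0)).
rewrite ltr_pdivrMr //; have := decr (Num.bound (eps K i / c)).
by have := restriction_gt0 (K + Num.bound (eps K i / c)) i; lra.
Qed.

Lemma eventually_all_agents (P : nat -> 'I_m -> Prop) :
  (forall i, exists K, forall k, (K <= k)%N -> P k i) ->
  exists K, forall k, (K <= k)%N -> forall i, P k i.
Proof.
move=> /choice[K HK]; exists (\max_i K i) => k Kk i; apply: HK.
exact: leq_trans (leq_bigmax i) Kk.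
Qed.

Variable xs : 'rV[R]_n.
Hypothesis xs_optimal : optimal (drco f g Y) xs.

Lemma upper_bounding_cvg : F (z k) @[k --> \oo] --> F xs.
Proof.
have [/drco_feasibleP xsX xsmin] := xs_optimal.
have xbarX : feasible (drco f g Y) xbar.
  apply/drco_feasibleP => i y Yy.
  by have := xbar_slater Yy; have := eps0_gt0 i; lra.
have D0 := xsmin _ xbarX.
have [e e0 He] := finite_positive_lbound (D' := [set: 'I_m]) finite_finset
  (fun i _ => eps0_gt0 i).
apply/cvgrPdist_le => eta eta0.
pose s := Num.min 1 (eta / (F xbar - F xs + 1)).
have s0 : 0 < s by rewrite lt_min ltr01 divr_gt0 //; lra.
have s1 : s <= 1 by rewrite ge_min lexx.
have sD : s * (F xbar - F xs) <= eta.
  have : s * (F xbar - F xs + 1) <= eta.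
    by rewrite -ler_pdivlMr ?ge_min ?lexx ?orbT //; lra.
  lra.
have se0 : 0 < s * e by rewrite mulr_gt0.
have [K1 HK1] := eventually_all_agents (fun i => violation_vanishes i se0).
have [K2 HK2] := eventually_all_agents (fun i => restriction_vanishes i se0).
exists (maxn K1 K2) => // k /=; rewrite geq_max => /andP[/HK1 viol /HK2 epsk].
have [/dubd_feasibleP zX zmin] := z_optimal k.
have /convex_functionP Fc := total_objective_convex.
(* feasibility of s xbar + (1 - s) xs for the k-th approximation problem *)
have up : F (z k) <= s * F xbar + (1 - s) * F xs.
  apply: le_trans (Fc xbar xs s (ltW s0) s1).
  apply: zmin; apply/dubd_feasibleP => i y /discretization_sub Yy.
  have /convex_functionP gc := g_convex Yy.
  have := gc xbar xs s (ltW s0) s1.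
  have h1 : s * (g i xbar y + e) <= 0.
    rewrite pmulr_rle0 //; have := He i I; have := xbar_slater Yy; lra.
  have h2 : (1 - s) * g i xs y <= 0 by rewrite mulr_ge0_le0 ?subr_ge0 // xsX.
  by have := epsk i; lra.
(* feasibility of (s xbar + z k) / (1 + s) for the robust program *)
have dn : (1 + s) * F xs <= F (z k) + s * F xbar.
  pose t := s / (1 + s).
  have sn0 : 1 + s != 0 by rewrite gt_eqF //; lra.
  have t0 : 0 <= t by rewrite divr_ge0 //; lra.
  have t1 : t <= 1 by rewrite ler_pdivrMr; lra.
  have tE a b : (1 + s) * (t * a + (1 - t) * b) = s * a + b.
    by rewrite /t; field.
  have ps : 0 < 1 + s by lra.
  have : F xs <= t * F xbar + (1 - t) * F (z k).
    apply: le_trans (Fc xbar (z k) t t0 t1).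
    apply: xsmin; apply/drco_feasibleP => i y Yy.
    have /convex_functionP gc := g_convex Yy.
    apply: le_trans (gc xbar (z k) t t0 t1) _.
    rewrite -(ler_pM2l ps) tE mulr0.
    have h1 : s * (g i xbar y + e) <= 0.
      rewrite pmulr_rle0 //; have := He i I; have := xbar_slater Yy; lra.
    by have := viol i y Yy; lra.
  move=> H; suff : (1 + s) * F xs <= s * F xbar + F (z k) by lra.
  by rewrite -tE ler_pM2l.
by rewrite ler_norml; apply/andP; split; lra.
Qed.

End Procedure.

(** * Convergence of the distributed procedure *)

Theorem proposition2 (R : realType) (m n p : nat)
  (f : 'I_m -> 'rV[R]_n -> R)
  (g : 'I_m -> 'rV[R]_n -> 'rV[R]_p -> R)
  (Y : 'I_m -> set 'rV[R]_p)
  (* standing assumptions on the data *)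
  (Y_nonempty : forall i, Y i !=set0)
  (Y_compact : forall i, compact (Y i))
  (f_convex : forall i, convex_function setT (f i))
  (g_convex : forall i y, Y i y -> convex_function setT ((g i)^~ y))
  (g_continuous : forall i x, {within Y i, continuous (g i x)})
  (X_convex : forall i, convex_set (local_feasible (drco f g Y) i))
  (X_compact : forall i, compact (local_feasible (drco f g Y) i))
  (* Assumption 1 *)
  (X_nonempty : feasible (drco f g Y) !=set0)
  (F_strictly_convex : strictly_convex_function (total_objective (drco f g Y)))
  (unique_solution : exists! x, optimal (drco f g Y) x)
  (* Assumption 2 *)
  (G : nat -> rel 'I_m)
  (G_connected : uniformly_strongly_connected G)
  (* Assumption 3 *)
  (slater : exists x0, forall i y, Y i y -> g i x0 y < 0)
  (* Assumption 4, first part *)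
  (A : distributed_algorithm R m n)
  (A_consensus : finite_time_consensus A)
  (* the procedure: initialization *)
  (r : R) (r_gt1 : 1 < r)
  (Yb : nat -> 'I_m -> set 'rV[R]_p) (eps : nat -> 'I_m -> R)
  (Yb0_finite : finite_discretization Y (Yb 0%N))
  (eps0_proper : proper_restriction f g Y r (eps 0%N))
  (* Assumption 4, second part: every approximation problem is solvable *)
  (dubd_solvable : forall k, optimal (dubd f g (Yb k) (eps k)) !=set0)
  (* iteration k takes place in the time slots s k, ..., s k.+1; [w k t i] is
     the decision variable of agent i after t slots of iteration k, which has
     settled on [z k.+1 i] by the end of the iteration *)
  (s : nat -> nat) (s_nondecreasing : forall k, (s k <= s k.+1)%N)
  (w : nat -> nat -> 'I_m -> 'rV[R]_n)
  (w_execution : forall k,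
     A (fun t => G (s k + t)%N) (dubd f g (Yb k) (eps k)) (w k))
  (z : nat -> 'I_m -> 'rV[R]_n)
  (z_obtained : forall k t i, (s k.+1 <= s k + t)%N -> w k t i = z k.+1 i)
  (* Assumption 5: the lower-level problems at the query points z k.+1 i *)
  (yhat : nat -> 'I_m -> option 'rV[R]_p)
  (yhat_solved : forall k i, lower_level_solved g Y i (z k.+1 i) (yhat k i))
  (Yb_update : forall k, Yb k.+1 = dubd_next_points (Yb k) (yhat k))
  (eps_update : forall k, eps k.+1 = dubd_next_restriction r (eps k) (yhat k)) :
  \sum_(i < m) f i (z k.+1 i) @[k --> \oo] --> optimal_value (drco f g Y).
Proof.
have [xs [xs_opt xs_unique]] := unique_solution.
have [b Xb] : exists b, forall x, feasible (drco f g Y) x -> `|x| <= b.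
  (* Without agents the objective is constant, so all points are optimal and
     uniqueness makes xs the only one. *)
  have [m0|m_gt0] := posnP m.
    exists `|xs| => x xX; suff -> : xs = x by [].
    apply: xs_unique; split=> // x' _.
    by rewrite /total_objective !big1 // => i; have := ltn_ord i;
      rewrite [X in (_ < X)%N]m0.
  have [M [_ HM]] := compact_bounded (X_compact (Ordinal m_gt0)).
  by exists (M + 1) => x xX; apply: (HM (M + 1)); [rewrite ltrDl | exact: xX].
have [eps0_gt0 _] := eps0_proper.
have [xbar xbar_slater] := proper_restriction_slater g_convex X_nonempty Xb eps0_proper.
have Yb_finite := discretizations_finite Yb0_finite yhat_solved Yb_update.
have dubd_convex k : convex_program (dubd f g (Yb k) (eps k)).
  split=> // i _ [y /(Yb_finite k i).2 Yy <-].
  by apply: convex_functionD; [exact: g_convex | exact: convex_function_cst].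
have /choice[x x_consensus] k : exists x,
    optimal (dubd f g (Yb k) (eps k)) x /\ forall i, z k.+1 i = x.
  have G_shift : uniformly_strongly_connected (fun t => G (s k + t)%N).
    have [T T0 GT] := G_connected; exists T => // t.
    move=> i j; have := GT (s k + t)%N i j.
    rewrite (eq_connect (e' := fun i j => [exists u : 'I_T,
      G (s k + (t + u))%N i j])) // => i' j'.
    by apply: eq_existsb => u; rewrite addnA.
  have [|x xopt [tau Htau]] := A_consensus _ _ _ G_shift
    (dubd_convex k) _ (dubd_solvable k) (w_execution k).
    move=> i; apply: finite_image; exact: (Yb_finite k i).1.
  exists x; split=> // i.
  (* a time slot after both the consensus and the end of iteration k *)
  rewrite -(z_obtained k (maxn tau (s k.+1))); first exact/Htau/leq_maxl.
  by rewrite (leq_trans (leq_maxr tau _)) // leq_addl.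
have x_optimal k : optimal (dubd f g (Yb k) (eps k)) (x k) by have [] := x_consensus k.
have x_solved k i : lower_level_solved g Y i (x k) (yhat k i).
  by have [_ zx] := x_consensus k; rewrite -(zx i).
rewrite (optimal_value_min xs_opt).
rewrite (_ : (fun k => _) = fun k => total_objective (drco f g Y) (x k)).
  exact: (upper_bounding_cvg f_convex g_convex Y_compact g_continuous r_gt1
    Yb0_finite eps0_gt0 x_optimal x_solved Yb_update eps_update xbar_slater
    F_strictly_convex xs_opt).
apply/funext => k; apply: eq_bigr => i _.
by have [_ ->] := x_consensus k.
Qed.
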